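(* Let $n\ge 1$ and let $\mathcal X=\{X^u\}_{u\in\mathbb Z^n}$ be an $n$-parameter filtration of a cell complex $X$. For each $q\ge 0$ and each fixed grade $u\in\mathbb Z^n$, $$\sum_{i=0}^q (-1)^{q+i}\mu_i(u)\ \ge\ \sum_{i=0}^q(-1)^{q+i}\left(\xi_0^i(u)-\sum_{p=1}^{i+1}\xi_p^{i+1-p}(u)\right),$$ where $\mu_i(u)=\dim H_i(X^u,\bigcup_{j=1}^nX^{u-e_j})$ are the homological Morse numbers and $\xi^q_p(u)$ are the Betti tables of the persistence modules $V_q=H_q(\mathcal X)$.
   Context: Fix a field $\mathbb F$; all homology is over $\mathbb F$ and $\dim$ means $\dim_{\mathbb F}$. Cell complexes. A cell complex is a finite graded set $X=\bigsqcup_{q\ge 0}X_q$ (elements of $X_q$ are called $q$-cells) with an incidence function $\kappa:X\times X\to\mathbb F$ such that $\kappa(\tau,\sigma)\ne0$ implies $\dim\tau=\dim\sigma+1$, and $\sum_{\rho}\kappa(\tau,\rho)\kappa(\rho,\sigma)=0$ for all $\tau,\sigma$. Its chain complex $C_*(X)$ has $C_q(X)$ with basis $X_q$ and $\partial_q(\tau)=\sum_{\sigma\in X_{q-1}}\kappa(\tau,\sigma)\sigma$. The partial order $\le$ on $X$ is generated by $\sigma<\tau$ whenever $\kappa(\tau,\sigma)\neq0$. A subcomplex $A\subseteq X$ is a subset generating a chain subcomplex $C_*(A)\subseteq C_*(X)$. $H_q(X)$ is the homology of $C_*(X)$, and $H_q(X,A)$ that of $C_*(X)/C_*(A)$. Filtrations.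 For $n\ge1$, $[n]=\{1,\dots,n\}$, $e_1,\dots,e_n$ is the standard basis of $\mathbb Z^n$, $e_\sigma=\sum_{j\in\sigma}e_j$ for $\sigma\subseteq[n]$, and $\preceq$ is the coordinatewise order on $\mathbb Z^n$. An $n$-parameter filtration of $X$ is a family $\{X^u\}_{u\in\mathbb Z^n}$ of subcomplexes with $X^u\subseteq X^v$ for $u\preceq v$. All filtrations are assumed one-critical, i.e. $X^u=\{\sigma\in X\mid f(\sigma)\preceq u\}$ for some order-preserving $f:(X,\le)\to(\mathbb Z^n,\preceq)$, and bounded, i.e. $X^u\neq\emptyset$ implies $0\preceq u$, and $X^u=X$ for $u$ sufficiently large. Homological Morse numbers: $\mu_q(u):=\dim H_q(X^u,\bigcup_{j=1}^nX^{u-e_j})$. Koszul complex and Betti tables. $V_q=H_q(\mathcal X)$ is the persistence module with $V_q^u=H_q(X^u)$ and maps $\iota_q^{u,v}:H_q(X^u)\to H_q(X^v)$ induced by inclusions. Its Koszul complex at grade $u$ has $\mathbb K_i(x_1,\dots,x_n;V_q)(u)=\bigoplus_{\sigma\subseteq[n],|\sigma|=i}H_q(X^{u-e_\sigma})$ for $0\le i\le n$ and $0$ otherwise; its differential $d_i$ restricted to the summand of $\sigma=\{j_1<\dots<j_i\}$ is $\sum_{r=0}^{i-1}(-1)^r\iota_q^{u-e_\sigma,\,u-e_{\sigma\setminus\{j_{i-r}\}}}$. The Betti table is $\xi_i^q(u):=\dim H_i(\mathbb K_*(x_1,\dots,x_n;V_q)(u))$ (so $\xi^q_i(u)=0$ unless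 $0\le i\le n$ and $q\ge0$). *)

(* Defs.v *)
From HB Require Import structures.

From mathcomp Require Import all_boot all_order all_algebra.

Set Implicit Arguments.
Unset Strict Implicit.
Unset Printing Implicit Defensive.

Import Order.TTheory GRing.Theory Num.Theory.
Import VectorInternalTheory.
Local Open Scope ring_scope.
Local Open Scope quotient_scope.

Section LinearAlgebra.
Variable F : fieldType.

Lemma linfunK (U V : vectType F) (f : U -> V) : linear f -> linfun f =1 f.
Proof.
move=> lf x.
pose g : {linear U -> V} := HB.pack f (GRing.isLinear.Build F U V *:%R f lf).
exact: (lfunE g x).
Qed.

Fact iso_vect_axiom (V : lmodType F) (W : vectType F) (f : V -> W) :
  linear f -> bijective f -> Vector.axiom (dim W) V.
Proof.
move=> lf bf; exists (fun x => v2r (f x)); first by move=> a x y; rewrite lf linearP.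
by apply: bij_comp bf; exists (@r2v F W); [exact: v2rK | exact: r2vK].
Qed.

End LinearAlgebra.

(* The quotient vector space V / U: MathComp's quotient of the additive group V
   by U, with its scaling. *)
Section QuotientSpace.
Variables (F : fieldType) (V : vectType F) (U : {vspace V}).

Definition quotv : Type := Quotient.quot (pred_of_vspace U).
HB.instance Definition _ := Choice.on quotv.
HB.instance Definition _ := GRing.Zmodule.on quotv.

Definition quotv_pi (x : V) : quotv :=
  \pi_(Quotient.quot (pred_of_vspace U)) x.
Definition quotv_repr (x : quotv) : V :=
  repr (x : Quotient.quot (pred_of_vspace U)).

Lemma quotv_reprK : cancel quotv_repr quotv_pi. Proof. exact: reprK. Qed.

Lemma quotv_eqP x y : reflect (quotv_pi x = quotv_pi y) (x - y \in U).
Proof. by rewrite -[_ \in U]/(_ \in pred_of_vspace U) Quotient.idealrBE; apply: eqP. Qed.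

Lemma quotv_piD x y : quotv_pi (x + y) = quotv_pi x + quotv_pi y.
Proof. exact: (raddfD (\pi_(Quotient.quot (pred_of_vspace U)))). Qed.

Definition quotv_scale (a : F) (x : quotv) := quotv_pi (a *: quotv_repr x).

Lemma quotv_piZ a x : quotv_pi (a *: x) = quotv_scale a (quotv_pi x).
Proof.
by apply/quotv_eqP; rewrite -scalerBr memvZ //; apply/quotv_eqP; rewrite quotv_reprK.
Qed.

Fact quotv_scaleA a b x : quotv_scale a (quotv_scale b x) = quotv_scale (a * b) x.
Proof. by rewrite -[x]quotv_reprK -!quotv_piZ scalerA. Qed.
Fact quotv_scale1 : left_id 1 quotv_scale.
Proof. by move=> x; rewrite -[x]quotv_reprK -quotv_piZ scale1r. Qed.
Fact quotv_scaleDr : right_distributive quotv_scale +%R.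
Proof.
move=> a x y; rewrite -[x]quotv_reprK -[y]quotv_reprK -quotv_piD -!quotv_piZ.
by rewrite scalerDr quotv_piD.
Qed.
Fact quotv_scaleDl x : {morph quotv_scale^~ x : a b / a + b}.
Proof. by move=> a b; rewrite -[x]quotv_reprK -!quotv_piZ scalerDl quotv_piD. Qed.

HB.instance Definition _ := GRing.Zmodule_isLmodule.Build F quotv
  quotv_scaleA quotv_scale1 quotv_scaleDr quotv_scaleDl.

Fact quotv_pi_linear : linear quotv_pi.
Proof. by move=> a x y; rewrite quotv_piD quotv_piZ. Qed.
HB.instance Definition _ := GRing.isLinear.Build F V quotv *:%R quotv_pi quotv_pi_linear.

(* Only used to see that quotv is finite-dimensional. *)
Definition quotv_compl (x : quotv) : subvs_of U^C :=
  vsproj U^C (daddv_pi U^C U (quotv_repr x)).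

Let compl_cap : (U^C :&: U)%VS = 0%VS. Proof. by rewrite capvC capv_compl. Qed.

Let compl_pi x : x - daddv_pi U^C U x \in U.
Proof.
have: daddv_pi U^C U x + daddv_pi U U^C x = x.
  by apply: daddv_pi_add; rewrite // addvC addv_complf memvf.
by move=> e; rewrite -{1}e addrAC subrr add0r memv_pi.
Qed.

Let compl_piP x y : quotv_pi x = quotv_pi y -> daddv_pi U^C U x = daddv_pi U^C U y.
Proof.
move/quotv_eqP => xyU; apply/eqP; rewrite -subr_eq0 -linearB /= -memv0 -compl_cap.
rewrite memv_cap memv_pi /=.
by rewrite -[X in X \in U](subKr (x - y)) memvB.
Qed.

Fact quotv_compl_linear : linear quotv_compl.
Proof.
move=> a x y; rewrite /quotv_compl -linearP /=; congr vsproj; rewrite -linearP.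
by apply: compl_piP; rewrite linearP /= !quotv_reprK.
Qed.

Fact quotv_compl_bij : bijective quotv_compl.
Proof.
exists (fun w => quotv_pi (vsval w)) => [x|w].
  rewrite /quotv_compl vsprojK ?memv_pi // -[RHS]quotv_reprK.
  by apply/esym/quotv_eqP/compl_pi.
apply: val_inj; rewrite /= /quotv_compl vsprojK ?memv_pi //.
have -> := compl_piP (quotv_reprK (quotv_pi (vsval w))).
by rewrite daddv_pi_id // subvsP.
Qed.

HB.instance Definition _ := Lmodule_hasFinDim.Build F quotv
  (iso_vect_axiom quotv_compl_linear quotv_compl_bij).

End QuotientSpace.

Definition quotv_map (F : fieldType) (V W : vectType F) (f : 'Hom(V, W))
    (U : {vspace V}) (U' : {vspace W}) : 'Hom(quotv U, quotv U') :=
  linfun (fun x => quotv_pi U' (f (quotv_repr x))).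

Lemma quotv_mapE (F : fieldType) (V W : vectType F) (f : 'Hom(V, W))
    (U : {vspace V}) (U' : {vspace W}) :
    (f @: U <= U')%VS ->
  forall x, quotv_map f U U' (quotv_pi U x) = quotv_pi U' (f x).
Proof.
move=> sfU.
have H x y : quotv_pi U x = quotv_pi U y -> quotv_pi U' (f x) = quotv_pi U' (f y).
  move/quotv_eqP => h; apply/quotv_eqP; rewrite -linearB.
  by apply: (subvP sfU); apply: memv_img.
move=> x; rewrite /quotv_map linfunK; first by apply/H/quotv_reprK.
move=> a y z; rewrite -linearP -linearP; apply: H.
by rewrite linearP /= !quotv_reprK.
Qed.

Section DirectSum.
Variables (F : fieldType) (I : finType) (T : I -> vectType F).

Definition dsum : Type := {dffun forall i, T i}.
HB.instance Definition _ := Choice.on dsum.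

Definition dsum_mk (f : forall i, T i) : dsum := finfun f.
Definition dsum_proj (i : I) (x : dsum) : T i := x i.

Lemma dsumP (x y : dsum) : (forall i, dsum_proj i x = dsum_proj i y) -> x = y.
Proof. by move=> e; apply/ffunP. Qed.
Lemma dsum_projE i f : dsum_proj i (dsum_mk f) = f i.
Proof. exact: ffunE. Qed.

Definition dsum_zero := dsum_mk (fun=> 0).
Definition dsum_opp (x : dsum) := dsum_mk (fun i => - dsum_proj i x).
Definition dsum_add (x y : dsum) := dsum_mk (fun i => dsum_proj i x + dsum_proj i y).
Definition dsum_scale (a : F) (x : dsum) := dsum_mk (fun i => a *: dsum_proj i x).

Fact dsum_addA : associative dsum_add.
Proof. by move=> x y z; apply: dsumP => i; rewrite !dsum_projE addrA. Qed.
Fact dsum_addC : commutative dsum_add.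
Proof. by move=> x y; apply: dsumP => i; rewrite !dsum_projE addrC. Qed.
Fact dsum_add0 : left_id dsum_zero dsum_add.
Proof. by move=> x; apply: dsumP => i; rewrite !dsum_projE add0r. Qed.
Fact dsum_addN : left_inverse dsum_zero dsum_opp dsum_add.
Proof. by move=> x; apply: dsumP => i; rewrite !dsum_projE addNr. Qed.
HB.instance Definition _ := GRing.isZmodule.Build dsum
  dsum_addA dsum_addC dsum_add0 dsum_addN.

Fact dsum_scaleA a b x : dsum_scale a (dsum_scale b x) = dsum_scale (a * b) x.
Proof. by apply: dsumP => i; rewrite !dsum_projE scalerA. Qed.
Fact dsum_scale1 : left_id 1 dsum_scale.
Proof. by move=> x; apply: dsumP => i; rewrite !dsum_projE scale1r. Qed.
Fact dsum_scaleDr : right_distributive dsum_scale +%R.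
Proof. by move=> a x y; apply: dsumP => i; rewrite !dsum_projE scalerDr. Qed.
Fact dsum_scaleDl x : {morph dsum_scale^~ x : a b / a + b}.
Proof. by move=> a b; apply: dsumP => i; rewrite !dsum_projE scalerDl. Qed.
HB.instance Definition _ := GRing.Zmodule_isLmodule.Build F dsum
  dsum_scaleA dsum_scale1 dsum_scaleDr dsum_scaleDl.

Fact dsum_proj_linear i : linear (dsum_proj i).
Proof. by move=> a x y; rewrite !dsum_projE. Qed.
HB.instance Definition _ i :=
  GRing.isLinear.Build F dsum (T i) *:%R (dsum_proj i) (dsum_proj_linear i).

(* Only used to see that dsum is finite-dimensional. *)
Definition dsum_coord (x : dsum) : {ffun {i : I & 'I_(dim (T i))} -> F^o} :=
  [ffun p => v2r (dsum_proj (tag p) x) 0 (tagged p)].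

Fact dsum_coord_linear : linear dsum_coord.
Proof. by move=> a x y; apply/ffunP => p; rewrite !ffunE !linearP !mxE. Qed.

Fact dsum_coord_bij : bijective dsum_coord.
Proof.
pose g (c : {ffun {i : I & 'I_(dim (T i))} -> F^o}) : dsum :=
  dsum_mk (fun i => r2v (\row_j (c (Tagged (fun i => 'I_(dim (T i))) j) : F))).
exists g => [x|c].
  apply: dsumP => i; rewrite dsum_projE; apply: (canLR v2rK).
  by apply/rowP => j; rewrite mxE ffunE.
by apply/ffunP => -[i j]; rewrite ffunE dsum_projE r2vK mxE.
Qed.

HB.instance Definition _ := Lmodule_hasFinDim.Build F dsum
  (iso_vect_axiom dsum_coord_linear dsum_coord_bij).

End DirectSum.

Record chain_complex (F : fieldType) := ChainComplex {
  cc_obj :> nat -> vectType F;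
  cc_diff : forall q, 'Hom(cc_obj q.+1, cc_obj q);
  cc_diff2 : forall q x, cc_diff q (cc_diff q.+1 x) = 0 }.

Section Homology.
Variable F : fieldType.
Implicit Types C D : chain_complex F.

(* The differential out of degree 0 is zero. *)
Definition cycles C (q : nat) : {vspace C q} :=
  match q return {vspace C q} with
  | 0 => fullv
  | q'.+1 => lker (cc_diff C q')
  end.

Definition boundaries C (q : nat) : {vspace C q} := limg (cc_diff C q).

Definition boundaries_in_cycles C (q : nat) : {vspace subvs_of (cycles C q)} :=
  (linfun vsval @^-1: boundaries C q)%VS.

Definition homology C (q : nat) : vectType F := quotv (boundaries_in_cycles C q).

(* The map induced on homology by a chain map f; a cycle of C is sent to a
   cycle of D, so vsproj only retypes it. *)
Definition homology_map C D (f : forall q, 'Hom(C q, D q)) (q : nat) :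
    'Hom(homology C q, homology D q) :=
  quotv_map (linfun (fun z : subvs_of (cycles C q) =>
                       vsproj (cycles D q) (f q (vsval z))))
            (boundaries_in_cycles C q) (boundaries_in_cycles D q).

Definition is_chain_map C D (f : forall q, 'Hom(C q, D q)) :=
  forall q x, cc_diff D q (f q.+1 x) = f q (cc_diff C q x).

Lemma chain_map_cycles C D f q x :
  @is_chain_map C D f -> x \in cycles C q -> f q x \in cycles D q.
Proof.
case: q x => [|q] x fP; rewrite /= ?memvf // !memv_ker fP => /eqP->.
by rewrite linear0.
Qed.

Lemma homology_mapE C D f q (z : subvs_of (cycles C q)) : @is_chain_map C D f ->
  homology_map f q (quotv_pi _ z) = quotv_pi _ (vsproj (cycles D q) (f q (vsval z))).
Proof.
move=> fP; rewrite quotv_mapE.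
  by rewrite linfunK // => a x y; rewrite !linearP.
apply/subvP => _ /memv_imgP[x xB ->].
rewrite linfunK; last by move=> a y w; rewrite !linearP.
rewrite -memv_preim lfunE /= vsprojK; last exact: chain_map_cycles (subvsP x).
move: xB; rewrite -memv_preim lfunE /= => /memv_imgP[y _ ->].
by rewrite -fP memv_img ?memvf.
Qed.

Record chain_subcomplex C := ChainSubcomplex {
  cs_sub :> forall q, {vspace C q};
  cs_stable : forall q, (cc_diff C q @: cs_sub q.+1 <= cs_sub q)%VS }.

Section Sub.
Variables (C : chain_complex F) (S : chain_subcomplex C).

Definition sub_diff q : 'Hom(subvs_of (S q.+1), subvs_of (S q)) :=
  linfun (fun x => vsproj (S q) (cc_diff C q (vsval x))).

Lemma sub_diffE q x : vsval (sub_diff q x) = cc_diff C q (vsval x).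
Proof.
rewrite linfunK; last by move=> a y z; rewrite !linearP.
rewrite vsprojK //; apply: (subvP (cs_stable S q)).
by apply/memv_img/subvsP.
Qed.

Fact sub_diff2 q x : sub_diff q (sub_diff q.+1 x) = 0.
Proof. by apply: val_inj; rewrite /= !sub_diffE cc_diff2. Qed.

Definition sub_complex : chain_complex F :=
  ChainComplex (cc_obj := fun q => subvs_of (S q)) sub_diff2.

Lemma sub_complex_diffE q x :
  vsval (cc_diff sub_complex q x) = cc_diff C q (vsval x).
Proof. exact: sub_diffE. Qed.

Definition quot_diff q : 'Hom(quotv (S q.+1), quotv (S q)) :=
  quotv_map (cc_diff C q) (S q.+1) (S q).

Fact quot_diff2 q x : quot_diff q (quot_diff q.+1 x) = 0.
Proof.
rewrite -[x]quotv_reprK /quot_diff !(quotv_mapE (cs_stable _ _)) cc_diff2.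
exact: linear0.
Qed.

Definition quot_complex : chain_complex F :=
  ChainComplex (cc_obj := fun q => quotv (S q)) quot_diff2.

End Sub.

(* The inclusion of sub-complexes; where S q is contained in S' q,
   vsproj only retypes a chain. *)
Definition sub_incl C (S S' : chain_subcomplex C) q :
    'Hom(sub_complex S q, sub_complex S' q) :=
  linfun (fun x : subvs_of (S q) => vsproj (S' q) (vsval x)).

Section SubSub.
Variables (C : chain_complex F) (S S' : chain_subcomplex C).

(* S' intersected with S, as a sub-complex of S. *)
Definition sub_sub_vs q : {vspace sub_complex S q} :=
  (linfun vsval @^-1: S' q)%VS.

Fact sub_sub_stable q :
  (cc_diff (sub_complex S) q @: sub_sub_vs q.+1 <= sub_sub_vs q)%VS.
Proof.
apply/subvP => _ /memv_imgP[x xS ->]; rewrite -memv_preim lfunE /= sub_diffE.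
apply: (subvP (cs_stable S' q)); apply: memv_img.
by move: xS; rewrite -memv_preim lfunE.
Qed.

Definition sub_sub : chain_subcomplex (sub_complex S) := ChainSubcomplex sub_sub_stable.

End SubSub.

End Homology.

Record cell_complex (F : fieldType) := CellComplex {
  cell :> finType;
  cdim : cell -> nat;
  kappa : cell -> cell -> F;
  kappa_dim : forall t s, kappa t s != 0 -> cdim t = (cdim s).+1;
  kappa_kappa : forall t s, \sum_r kappa t r * kappa r s = 0 }.

Section CellComplex.
Variables (F : fieldType) (X : cell_complex F).

Definition cell_le : rel X := connect (fun s t => kappa t s != 0).

Definition qcell (q : nat) : finType := {s : X | cdim s == q}.

Definition chain (q : nat) : vectType F := {ffun qcell q -> F^o}.

Definition bchain q (s : qcell q) : chain q := [ffun s' => (s' == s)%:R].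

Definition bdry_bchain q (t : qcell q.+1) : chain q :=
  \sum_(s : qcell q) (kappa (val t) (val s) : F) *: bchain s.

Definition bdry q : 'Hom(chain q.+1, chain q) :=
  linfun (fun c : chain q.+1 => \sum_t (c t : F) *: bdry_bchain t).

Lemma bdryE q (c : chain q.+1) s : bdry q c s = \sum_t (c t : F) * kappa (val t) (val s).
Proof.
rewrite linfunK; last first.
  move=> a y z; rewrite scaler_sumr -big_split; apply: eq_bigr => t _ /=.
  by rewrite !ffunE scalerDl scalerA.
rewrite sum_ffunE; apply: eq_bigr => t _; rewrite ffunE; congr (_ * _).
rewrite sum_ffunE (bigD1 s) //= !ffunE eqxx big1 ?addr0 ?[_ *: _]mulr1 // => s' s's.
by rewrite !ffunE eq_sym (negPf s's) [_ *: _]mulr0.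
Qed.

Lemma big_qcell q (g : X -> F) :
  \sum_(s : X | cdim s == q) g s = \sum_(s : qcell q) g (val s).
Proof.
rewrite (reindex_omap (val : qcell q -> X) insub) => [|s sq]; last by rewrite insubT.
by apply: eq_bigl => -[s sq] /=; rewrite insubT sq /= eqxx.
Qed.

Fact bdry2 q x : bdry q (bdry q.+1 x) = 0.
Proof.
apply/ffunP => s; rewrite bdryE ffunE.
under eq_bigr do rewrite bdryE mulr_suml.
rewrite exchange_big big1 //= => t _.
under eq_bigr do rewrite -mulrA.
rewrite -mulr_sumr; apply/eqP; rewrite mulf_eq0; apply/orP; right; apply/eqP.
rewrite -[RHS](kappa_kappa (val t) (val s)).
rewrite (bigID (fun r : X => cdim r == q.+1)) /= [Y in _ = _ + Y]big1 ?addr0.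
  by rewrite (big_qcell q.+1 (fun r => kappa (val t) r * kappa r (val s))).
move=> r rq; have [->|/kappa_dim e] := eqVneq (kappa r (val s)) 0; first by rewrite mulr0.
by case/negP: rq; rewrite e (eqP (valP s)).
Qed.

Definition cell_chain_complex : chain_complex F := ChainComplex bdry2.

Definition chain_of (A : {set X}) q : {vspace chain q} :=
  (\sum_(s : qcell q | val s \in A) <[bchain s]>)%VS.

Record subcomplex := Subcomplex {
  sc_set :> {set X};
  sc_stable : forall q, (bdry q @: chain_of sc_set q.+1 <= chain_of sc_set q)%VS }.

Definition sc_chains (A : subcomplex) : chain_subcomplex cell_chain_complex :=
  @ChainSubcomplex F cell_chain_complex (chain_of A) (@sc_stable A).

Definition sc_complex (A : subcomplex) : chain_complex F := sub_complex (sc_chains A).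

Lemma chain_ofP (A : {set X}) q (c : chain q) :
  reflect (forall s, val s \notin A -> c s = 0) (c \in chain_of A q).
Proof.
apply: (iffP memv_sumP) => [[v vA ->] s sA | cA].
  rewrite sum_ffunE big1 // => t tA; have /vlineP[k ->] := vA t tA.
  rewrite !ffunE; have [st|_] := eqVneq s t; last exact: mulr0.
  by rewrite st tA in sA.
exists (fun s => (c s : F) *: bchain s) => [s _|]; first by rewrite memvZ ?memv_line.
apply/ffunP => s; rewrite sum_ffunE.
have [sA|sA] := boolP (val s \in A).
  rewrite (bigD1 s) //= !ffunE eqxx big1 ?addr0 ?[_ *: _]mulr1 // => t /andP[_ ts].
  by rewrite !ffunE eq_sym (negPf ts) [_ *: _]mulr0.
rewrite cA // big1 // => t tA; rewrite !ffunE.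
have [st|_] := eqVneq s t; last exact: mulr0.
by rewrite st tA in sA.
Qed.

Lemma chain_ofS (A B : {set X}) q : A \subset B -> (chain_of A q <= chain_of B q)%VS.
Proof.
move=> sAB; apply/subvP => c /chain_ofP cA; apply/chain_ofP => s sB; apply: cA.
by apply: contra sB; apply: (subsetP sAB).
Qed.

Fact bigcup_stable (I : finType) (A : I -> subcomplex) q :
  (bdry q @: chain_of (\bigcup_i A i) q.+1 <= chain_of (\bigcup_i A i) q)%VS.
Proof.
rewrite {1}/chain_of limg_sum; apply/subv_sumP => t /bigcupP[i _ tA].
apply: subv_trans (chain_ofS q (bigcup_sup i isT)).
apply: subv_trans (sc_stable (A i) q); apply: limgS.
exact: (sumv_sup t).
Qed.

Definition sc_bigcup (I : finType) (A : I -> subcomplex) : subcomplex :=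
  Subcomplex (bigcup_stable A).

Definition sc_homology (q : nat) (A : subcomplex) : vectType F := homology (sc_complex A) q.

Definition sc_homology_incl (q : nat) (A B : subcomplex) : 'Hom(sc_homology q A, sc_homology q B) :=
  homology_map (sub_incl (sc_chains A) (sc_chains B)) q.

(* H_q(A, B), the homology of C_*(A) / C_*(B); meant for B contained in A. *)
Definition sc_rel_homology (q : nat) (A B : subcomplex) : vectType F :=
  homology (quot_complex (sub_sub (sc_chains A) (sc_chains B))) q.

End CellComplex.

Section Inclusion.
Variables (F : fieldType) (X : cell_complex F).
Implicit Types A B C : subcomplex X.

Lemma sub_inclE A B q x : A \subset B ->
  vsval (sub_incl (sc_chains A) (sc_chains B) q x) = vsval x.
Proof.
move=> sAB; rewrite linfunK; last by move=> a y z; rewrite !linearP.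
by rewrite vsprojK //; apply: (subvP (chain_ofS q sAB)); apply: subvsP.
Qed.

Lemma sub_incl_chain_map A B : A \subset B ->
  is_chain_map (sub_incl (sc_chains A) (sc_chains B)).
Proof.
by move=> sAB q x; apply: subvs_inj; rewrite [LHS]sub_complex_diffE !sub_inclE // sub_complex_diffE.
Qed.

Lemma sc_homology_incl_id q A x : sc_homology_incl q A A x = x.
Proof.
rewrite -[x]quotv_reprK homology_mapE; last exact: sub_incl_chain_map.
congr quotv_pi; apply: subvs_inj.
have e y : sub_incl (sc_chains A) (sc_chains A) q y = y by apply: subvs_inj; apply: sub_inclE.
by rewrite /= e vsvalK.
Qed.

Lemma sc_homology_incl_comp q A B C x : A \subset B -> B \subset C ->
  sc_homology_incl q B C (sc_homology_incl q A B x) = sc_homology_incl q A C x.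
Proof.
move=> sAB sBC; have sAC := subset_trans sAB sBC.
rewrite -[x]quotv_reprK !homology_mapE; try exact: sub_incl_chain_map.
congr quotv_pi; congr vsproj; apply: subvs_inj; rewrite !sub_inclE //.
rewrite vsprojK ?sub_inclE //.
by apply: chain_map_cycles (subvsP _); apply: sub_incl_chain_map.
Qed.

End Inclusion.

Definition preceq n (u v : 'rV[int]_n) : bool := [forall j, u 0 j <= v 0 j].

Definition unit_grade n (s : {set 'I_n}) : 'rV[int]_n := \row_j (j \in s)%:R.

(* The structure map pm_map u v only carries meaning for preceq u v. *)
Record persistence_module (F : fieldType) (n : nat) := PersistenceModule {
  pm_obj :> 'rV[int]_n -> vectType F;
  pm_map : forall u v, 'Hom(pm_obj u, pm_obj v);
  pm_id : forall u x, pm_map u u x = x;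
  pm_comp : forall u v w x, preceq u v -> preceq v w ->
    pm_map v w (pm_map u v x) = pm_map u w x }.

Section Koszul.
Variables (F : fieldType) (n : nat) (V : persistence_module F n) (u : 'rV[int]_n).

Definition subsets_of_size (i : nat) : finType := {s : {set 'I_n} | #|s| == i}.

Definition koszul_obj (i : nat) : vectType F :=
  dsum (fun s : subsets_of_size i => V (u - unit_grade (val s))).

(* If s = {j_1 < ... < j_i} and j = j_(i-r), then r is the number of elements
   of s above j. *)
Definition koszul_sign (s : {set 'I_n}) (j : 'I_n) : F :=
  (-1) ^+ #|[set k in s | (j < k)%N]|.

Definition koszul_fun (i : nat) (x : koszul_obj i.+1) : koszul_obj i :=
  dsum_mk (fun t : subsets_of_size i =>
    \sum_(s : subsets_of_size i.+1) \sum_(j in val s | val s :\ j == val t)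
      koszul_sign (val s) j *:
        pm_map V (u - unit_grade (val s)) (u - unit_grade (val t)) (dsum_proj s x)).

Definition koszul_diff (i : nat) : 'Hom(koszul_obj i.+1, koszul_obj i) :=
  linfun (@koszul_fun i).

Fact koszul_fun_linear i : linear (@koszul_fun i).
Proof.
move=> a x y; apply: dsumP => t; rewrite linearP /= !dsum_projE scaler_sumr -big_split.
apply: eq_bigr => s _; rewrite scaler_sumr -big_split; apply: eq_bigr => j _ /=.
by rewrite !linearP.
Qed.

Lemma koszul_diffE i x : koszul_diff i x = koszul_fun x.
Proof. exact/linfunK/koszul_fun_linear. Qed.

Lemma preceq_unit_grade (s t : {set 'I_n}) : t \subset s ->
  preceq (u - unit_grade s) (u - unit_grade t).
Proof.
move=> /subsetP ts; apply/forallP => j; rewrite !mxE lerD2l lerN2 ler_nat.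
by case: (boolP (j \in t)) => // /ts ->.
Qed.

Lemma koszul_sign_swap (s : {set 'I_n}) j k : j \in s -> k \in s -> (j < k)%N ->
  koszul_sign (s :\ k) j * koszul_sign s k = - (koszul_sign (s :\ j) k * koszul_sign s j).
Proof.
move=> js ks jk; rewrite /koszul_sign.
have -> : [set l in s :\ j | (k < l)%N] = [set l in s | (k < l)%N].
  apply/setP => l; rewrite !inE; have [->|//] := eqVneq l j.
  by rewrite [(k < j)%N]ltnNge (ltnW jk) !andbF.
have -> : [set l in s :\ k | (j < l)%N] = [set l in s | (j < l)%N] :\ k.
  by apply/setP => l; rewrite !inE -andbA.
rewrite [#|[set l in s | (j < l)%N]|](cardsD1 k) !inE ks jk /= add1n exprS.
by rewrite mulN1r mulrN opprK mulrC.
Qed.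

Lemma koszul_sign_sum (r t : {set 'I_n}) :
  \sum_j \sum_k (if [&& k \in r, j \in r, j != k & r :\ k :\ j == t]
                  then koszul_sign (r :\ k) j * koszul_sign r k else 0) = 0.
Proof.
pose b j k := [&& k \in r, j \in r, j != k & r :\ k :\ j == t].
pose a j k := koszul_sign (r :\ k) j * koszul_sign r k.
have bC j k : b j k = b k j.
  by rewrite /b eq_sym andbCA; congr [&& _, _, _ & _ == t]; rewrite !setDDl setUC.
have split_lt j k : (if b j k then a j k else 0) =
    (if b j k && (j < k)%N then a j k else 0) + (if b j k && (k < j)%N then a j k else 0).
  have [|] := boolP (b j k); last by rewrite addr0.
  case/and4P=> _ _ jk _ /=.
  by case: (ltngtP j k) => [||/val_inj e]; rewrite ?addr0 ?add0r // e eqxx in jk *.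
transitivity (\sum_j ((\sum_k if b j k && (j < k)%N then a j k else 0) +
                      (\sum_k if b j k && (k < j)%N then a j k else 0))).
  by apply: eq_bigr => j _; rewrite -big_split; apply: eq_bigr => k _; exact: split_lt.
rewrite big_split /= [Y in _ + Y]exchange_big -big_split big1 //= => j _.
rewrite -big_split big1 //= => k _; rewrite (bC k j).
case: ifP => [/andP[/and4P[kr jr _ _] jk]|_]; last by rewrite addr0.
by rewrite /a koszul_sign_swap // addNr.
Qed.

Fact koszul_diff2 i x : koszul_diff i (koszul_diff i.+1 x) = 0.
Proof.
rewrite !koszul_diffE; apply: dsumP => t; rewrite linear0 dsum_projE.
pose y (r : subsets_of_size i.+2) :=
  pm_map V (u - unit_grade (val r)) (u - unit_grade (val t)) (dsum_proj r x).
pose b (s : subsets_of_size i.+1) j (r : subsets_of_size i.+2) k :=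
  [&& k \in val r, val r :\ k == val s, j \in val s & val s :\ j == val t].
transitivity (\sum_(s : subsets_of_size i.+1) \sum_j \sum_(r : subsets_of_size i.+2)
    \sum_k if b s j r k then (koszul_sign (val s) j * koszul_sign (val r) k) *: y r else 0).
  apply: eq_bigr => s _; rewrite big_mkcond; apply: eq_bigr => j _.
  rewrite dsum_projE; case: ifPn => [/andP[js st]|sj]; last first.
    rewrite big1 // => r _; rewrite big1 // => k _; rewrite /b (negPf sj) !andbF.
    by [].
  rewrite linear_sum scaler_sumr; apply: eq_bigr => r _.
  rewrite linear_sum scaler_sumr big_mkcond; apply: eq_bigr => k _.
  rewrite /b js st !andbT; case: ifP => // /andP[_ /eqP rs].
  rewrite linearZ /= scalerA pm_comp //; apply: preceq_unit_grade.
    by rewrite -rs subD1set.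
  by rewrite -(eqP st) subD1set.
under eq_bigr => s _ do rewrite exchange_big.
rewrite exchange_big big1 //= => r _.
rewrite exchange_big /=; under eq_bigr => j _ do rewrite exchange_big.
transitivity ((\sum_j \sum_k (if [&& k \in val r, j \in val r, j != k & val r :\ k :\ j == val t]
    then koszul_sign (val r :\ k) j * koszul_sign (val r) k else 0)) *: y r); last first.
  by rewrite koszul_sign_sum scale0r.
rewrite scaler_suml; apply: eq_bigr => j _; rewrite scaler_suml; apply: eq_bigr => k _ /=.
have [kr|kr] := boolP (k \in val r); last first.
  by rewrite scale0r big1 // => s _; rewrite /b (negPf kr).
have rk : #|val r :\ k| == i.+1.
  by have := valP r; rewrite (cardsD1 k) kr /= add1n eqSS.
rewrite (bigD1 (Sub (val r :\ k) rk)) //= big1 ?addr0 => [|s ns].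
  by rewrite /b kr /= eqxx !inE /= andbA [(j \in _) && _]andbC; case: ifP; rewrite ?scale0r.
rewrite /b; case: ifP => // /and4P[_ /eqP e _ _].
by case/eqP: ns; apply: val_inj.
Qed.

Definition koszul_complex : chain_complex F :=
  ChainComplex (cc_obj := koszul_obj) koszul_diff2.

End Koszul.

Definition betti (F : fieldType) n (V : persistence_module F n) (i : nat)
    (u : 'rV[int]_n) : nat :=
  \dim {: homology (koszul_complex V u) i}.

Record filtration (F : fieldType) (n : nat) (X : cell_complex F) := Filtration {
  fil :> 'rV[int]_n -> subcomplex X;
  fil_mono : forall u v, preceq u v -> fil u \subset fil v;
  fil_one_critical : exists f : X -> 'rV[int]_n,
    (forall s t, cell_le s t -> preceq (f s) (f t)) /\
    (forall u, fil u = [set s | preceq (f s) u] :> {set X});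
  fil_bounded_below : forall u, fil u != set0 :> {set X} -> preceq 0 u;
  fil_bounded_above : exists w, forall u, preceq w u -> fil u = [set: X] :> {set X} }.

Section Filtration.
Variables (F : fieldType) (n : nat) (X : cell_complex F) (K : filtration n X).

Definition fil_boundary (u : 'rV[int]_n) : subcomplex X :=
  sc_bigcup (fun j : 'I_n => K (u - unit_grade [set j])).

Definition morse_number (q : nat) (u : 'rV[int]_n) : nat :=
  \dim {: sc_rel_homology q (K u) (fil_boundary u)}.

Definition persistent_homology (q : nat) : persistence_module F n :=
  @PersistenceModule F n (fun u => sc_homology q (K u)) (fun u v => sc_homology_incl q (K u) (K v))
    (fun u x => sc_homology_incl_id x)
    (fun u v w x uv vw => sc_homology_incl_comp x (fil_mono K uv) (fil_mono K vw)).

(* xi p q u is the p-th Betti number at grade u of the q-th homology. *)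
Definition xi (p q : nat) (u : 'rV[int]_n) : nat := betti (persistent_homology q) p u.

End Filtration.

(* Main.v *)
(* Fix u and let T_(p, q) be the sum of the C_q(X^(u - e_s)) over |s| = p, a
   double complex with vertical differential dv and Koszul differential kh;
   put D = dv + kh.  With Z = ker dv inside T_(p, q), the part of degree p of
   the Koszul complex of V_q is Z / dv T_(p, q+1).  Every element dv a + kh b
   with dv b = 0 is the leading term, for the filtration by p, of the boundary
   D (a + b); together with Z_(0, m) this bounds from below the kernel of D in
   total degree m.  On the other hand C_*(X^u, U_j X^(u - e_j)) is a quotient of
   the total complex, and one-criticality says that the kernel of the quotient
   map has, over each cell it involves, the exterior algebra on a nonempty set
   of directions; pairing s with s + {j} for one such direction j bounds from
   below the rank of D.  Each alternating sum of the theorem is, up to the rank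
   or nullity of a map out of degree q + 1, an alternating sum of numbers of
   cells, and rank-nullity for D in that degree compares them. *)

Require Import Defs.
From HB Require Import structures.
From mathcomp Require Import all_boot all_order all_algebra.
From mathcomp Require Import zify.

Set Implicit Arguments.
Unset Strict Implicit.
Unset Printing Implicit Defensive.

Import Order.TTheory GRing.Theory Num.Theory.
Local Open Scope ring_scope.

(** * Supports and dimensions *)

Section FunctionSupport.
Variables (F : fieldType) (I : finType).
Local Notation W := {ffun I -> F^o}.
Implicit Types (A B : {set I}) (w : W).

Definition restr A : 'End(W) :=
  linfun (fun w : W => [ffun x => if x \in A then w x else 0] : W).

Lemma restrE A w x : restr A w x = if x \in A then w x else 0.
Proof.
rewrite linfunK ?ffunE // => a v v'; apply/ffunP => y; rewrite !ffunE.
by case: ifP => //; rewrite scaler0 addr0.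
Qed.

Definition supp A : {vspace W} := limg (restr A).

Lemma suppP A w : reflect (forall x, x \notin A -> w x = 0) (w \in supp A).
Proof.
apply: (iffP memv_imgP) => [[v _ ->] x xA|w0]; first by rewrite restrE (negPf xA).
exists w; rewrite ?memvf //; apply/ffunP => x; rewrite restrE.
by case: ifPn => // /w0.
Qed.

Lemma suppS A B : A \subset B -> (supp A <= supp B)%VS.
Proof.
move=> AB; apply/subvP => w /suppP wA; apply/suppP => x xB; apply: wA.
by apply: contra xB; apply: (subsetP AB).
Qed.

Lemma restr_supp A w : restr A w \in supp A.
Proof. by apply/suppP => x xA; rewrite restrE (negPf xA). Qed.

(** The indicator functions of points of a set span its [supp], which bounds the dimension above for
    every set. Applying this bound to the complement as well, rank-nullity for [restr (~: A)], whose
    kernel is [supp A], leaves no room for strict inequality. *)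
Lemma dim_supp A : \dim (supp A) = #|A|.
Proof.
have le B : (\dim (supp B) <= #|B|)%N.
  pose d x : W := [ffun y => (y == x)%:R].
  suff s : (supp B <= <<[seq d x | x in B]>>)%VS.
    by apply: leq_trans (dimvS s) _; apply: leq_trans (dim_span _) _; rewrite size_map cardE.
  apply/subvP => w /suppP wB.
  have -> : w = \sum_(x in B) (w x : F) *: d x.
    apply/ffunP => y; rewrite sum_ffunE; have [yB|yB] := boolP (y \in B).
      rewrite (bigD1 y) //= !ffunE eqxx [_ *: _]mulr1 big1 ?addr0 // => x /andP[_ xy].
      by rewrite !ffunE eq_sym (negPf xy) [_ *: _]mulr0.
    rewrite wB // big1 // => x xB; rewrite !ffunE; have [e|_] := eqVneq y x; last exact: mulr0.
    by rewrite e xB in yB.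
  by apply: memv_suml => x xB; rewrite memvZ // memv_span // map_f // mem_enum.
apply/eqP; rewrite eqn_leq le -(leq_add2r #|~: A|) cardsC.
have <- : \dim {:W} = #|I| by rewrite dimvf -[LHS]/(#|I| * 1)%N muln1.
rewrite -(limg_ker_dim (restr (~: A)) fullv) capfv.
have -> : lker (restr (~: A)) = supp A.
  apply/vspaceP => w; rewrite memv_ker; apply/eqP/suppP => [w0 x xA|w0].
    by have /ffunP/(_ x) := w0; rewrite restrE inE xA ffunE.
  by apply/ffunP => x; rewrite restrE inE ffunE; case: ifP => // /w0.
rewrite leq_add2l.
apply: leq_trans (le _); apply: dimvS; apply/subvP => _ /memv_imgP[w _ ->].
exact: restr_supp.
Qed.

(** The weight [e] filters [V] by supports, and [restr] to [e x == k] reads off leading terms of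
    weight [k]. An element of the next step with zero leading term lies in the previous step, so
    rank-nullity adds up the leading-term dimensions. *)
Lemma dim_filtration (e : I -> nat) (V : {vspace W}) m :
  (\sum_(0 <= k < m) \dim (restr [set x | e x == k] @: (V :&: supp [set x | (e x < k.+1)%N]))
    <= \dim (V :&: supp [set x | (e x < m)%N]))%N.
Proof.
elim: m => [|m IH]; first by rewrite big_nil.
rewrite big_nat_recr //= -(limg_ker_dim (restr [set x | e x == m]) (V :&: supp [set x | (e x < m.+1)%N])) leq_add2r.
apply: leq_trans IH (dimvS _); apply/subvP => w; rewrite !memv_cap => /andP[wV /suppP wm].
rewrite wV /=; apply/andP; split.
  apply/suppP => x xm; apply: wm; move: xm; rewrite !inE; apply: contra => h.
  exact: ltnW.
rewrite memv_ker; apply/eqP/ffunP => x; rewrite restrE ffunE inE; case: eqP => // xm.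
by apply: wm; rewrite inE xm ltnn.
Qed.

End FunctionSupport.

(** * Dimensions of quotients and of homology *)

Section QuotientDimension.
Variables (F : fieldType) (V : vectType F).

Lemma dim_subvs (U : {vspace V}) : \dim {: subvs_of U} = \dim U.
Proof. by rewrite dimvf. Qed.

Lemma quotv_pi_img (U : {vspace V}) : limg (linfun (quotv_pi U)) = fullv.
Proof.
apply/vspaceP => x; rewrite memvf -[x]quotv_reprK -lfunE.
by rewrite memv_img ?memvf.
Qed.

Lemma quotv_pi_eq0 (U : {vspace V}) x : (quotv_pi U x == 0) = (x \in U).
Proof.
rewrite -[0](linear0 (quotv_pi U)).
by apply/eqP/idP => [/quotv_eqP|h]; [rewrite subr0|apply/quotv_eqP; rewrite subr0].
Qed.

Lemma dim_quotv (U : {vspace V}) : (\dim {: quotv U} + \dim U = \dim {: V})%N.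
Proof.
rewrite -quotv_pi_img addnC -(limg_ker_dim (linfun (quotv_pi U)) fullv) capfv.
congr (\dim _ + _)%N; apply/vspaceP => x.
by rewrite memv_ker lfunE /= quotv_pi_eq0.
Qed.

End QuotientDimension.

(** Boundaries are cycles and the inclusion of the cycles is injective, so taking the preimage
    [boundaries_in_cycles] preserves the dimension of the boundaries. *)
Lemma dim_homology (F : fieldType) (C : chain_complex F) q :
  (\dim {: homology C q} + \dim (boundaries C q) = \dim (cycles C q))%N.
Proof.
rewrite -(dim_subvs (cycles C q)) -(dim_quotv (boundaries_in_cycles C q)); congr (_ + _)%N.
have sBZ : (boundaries C q <= limg (linfun (vsval : subvs_of (cycles C q) -> _)))%VS.
  apply/subvP => x xB; have xZ : x \in cycles C q.
    case: q x xB => [|q] x; rewrite /= ?memvf // => /memv_imgP[y _ ->].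
    by rewrite memv_ker cc_diff2.
  by rewrite -(vsprojK xZ) -(lfunE vsval) memv_img ?memvf.
rewrite -{1}(lpreimK sBZ) limg_dim_eq //; apply/eqP; rewrite -subv0; apply/subvP => x.
by rewrite memv_cap memv_ker lfunE memv0 => /andP[_ /eqP x0]; apply/eqP/subvs_inj.
Qed.

(** * Absolute and relative homology classes *)

Section Classes.
Variables (F : fieldType) (X : cell_complex F).
Implicit Types A B : subcomplex X.

Definition cycles_of A q : {vspace chain X q} :=
  (chain_of A q :&: cycles (cell_chain_complex X) q)%VS.

(** A linear map on all chains, so that representatives never need retyping; its value is the
    homology class only for [c] in [cycles_of A q]. *)
Definition hclass q A : 'Hom(chain X q, sc_homology q A) :=
  linfun (fun c => quotv_pi (boundaries_in_cycles (sc_complex A) q)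
                     (vsproj (cycles (sc_complex A) q) (vsproj (chain_of A q) c))).

Lemma hclassE q A c :
  hclass q A c = quotv_pi (boundaries_in_cycles (sc_complex A) q)
                     (vsproj (cycles (sc_complex A) q) (vsproj (chain_of A q) c)).
Proof. by rewrite linfunK // => a x y; rewrite !linearP. Qed.

Lemma sc_cyclesE q A (c : sc_complex A q) :
  (c \in cycles (sc_complex A) q) = (vsval c \in cycles (cell_chain_complex X) q).
Proof.
case: q c => [|q] c; first by rewrite !memvf.
rewrite [LHS](memv_ker (cc_diff (sc_complex A) q)) [RHS](memv_ker (bdry X q)).
have <- : vsval (cc_diff (sc_complex A) q c) = bdry X q (vsval c) by exact: sub_complex_diffE.
by apply/eqP/eqP => [->|h]; rewrite ?linear0 //; apply: subvs_inj; rewrite linear0.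
Qed.

Lemma vsproj_cycles q A c : c \in cycles_of A q ->
  vsproj (chain_of A q) c \in cycles (sc_complex A) q.
Proof. by rewrite memv_cap sc_cyclesE => /andP[cA]; rewrite /= vsprojK. Qed.

Lemma hclass_surj q A (x : sc_homology q A) :
  exists2 c, c \in cycles_of A q & hclass q A c = x.
Proof.
pose z := quotv_repr x; exists (vsval (vsval z)).
  by rewrite memv_cap subvsP -sc_cyclesE subvsP.
by rewrite hclassE !vsvalK quotv_reprK.
Qed.

Lemma hclass_eq0 q A c : c \in cycles_of A q ->
  (hclass q A c == 0) = (c \in bdry X q @: chain_of A q.+1)%VS.
Proof.
move=> cZ; have cA : c \in chain_of A q by move: cZ; rewrite memv_cap => /andP[].
rewrite hclassE quotv_pi_eq0 -memv_preim lfunE /= vsprojK ?vsproj_cycles //.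
apply/memv_imgP/memv_imgP => -[b bA e].
  by exists (vsval b); [exact: subvsP | rewrite -(vsprojK cA) e; exact: (@sub_complex_diffE _ _ (sc_chains A))].
exists (vsproj (chain_of A q.+1) b); first exact: memvf.
by apply: subvs_inj; rewrite [RHS](@sub_complex_diffE _ _ (sc_chains A)) /= !vsprojK.
Qed.

Lemma hclass_incl q A B c : A \subset B -> c \in cycles_of A q ->
  sc_homology_incl q A B (hclass q A c) = hclass q B c.
Proof.
move=> AB cZ; rewrite !hclassE homology_mapE; last exact: sub_incl_chain_map.
congr quotv_pi; congr vsproj; rewrite /= vsprojK ?vsproj_cycles //.
have cA : c \in chain_of A q by move: cZ; rewrite memv_cap => /andP[].
apply: subvs_inj; rewrite sub_inclE // !vsprojK //.
exact: subvP (chain_ofS q AB) _ cA.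
Qed.

Lemma dim_chain_of (A : {set X}) q : \dim (chain_of A q) = #|[set s in A | cdim s == q]|.
Proof.
have -> : chain_of A q = supp F [set s : qcell X q | val s \in A].
  apply/vspaceP => c; apply/chain_ofP/suppP => h s; rewrite ?inE => sA.
    exact: h.
  by apply: h; rewrite inE.
rewrite dim_supp -(card_imset _ val_inj); apply: eq_card => s; rewrite !inE.
apply/imsetP/andP => [[t]|[sA sq]]; first by rewrite inE => tA ->; rewrite tA (valP t).
by exists (Sub s sq); rewrite ?inE.
Qed.

(** As with [hclass], this is total, and is the class of [c] modulo the chains of [B] only when [c]
    is a chain of [A]. *)
Definition rclass q A B :
    'Hom(chain X q, quot_complex (sub_sub (sc_chains A) (sc_chains B)) q) :=
  linfun (fun c => quotv_pi (sub_sub_vs (sc_chains A) (sc_chains B) q)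
                     (vsproj (chain_of A q) c)).

Lemma rclassE q A B c :
  rclass q A B c = quotv_pi (sub_sub_vs (sc_chains A) (sc_chains B) q)
                     (vsproj (chain_of A q) c).
Proof. by rewrite linfunK // => a x y; rewrite !linearP. Qed.

Lemma rclass_surj q A B x : exists2 c, c \in chain_of A q & rclass q A B c = x.
Proof.
exists (vsval (quotv_repr x)); first exact: subvsP.
by rewrite rclassE vsvalK quotv_reprK.
Qed.

Lemma rclass_eq0 q A B c : c \in chain_of A q -> (rclass q A B c == 0) = (c \in chain_of B q).
Proof. by move=> cA; rewrite rclassE quotv_pi_eq0 -memv_preim lfunE /= vsprojK. Qed.

Lemma rclass_diff q A B c : c \in chain_of A q.+1 ->
  cc_diff (quot_complex (sub_sub (sc_chains A) (sc_chains B))) q (rclass q.+1 A B c) =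
  rclass q A B (bdry X q c).
Proof.
move=> cA; rewrite !rclassE [LHS]quotv_mapE; last exact: (cs_stable (sub_sub _ _)).
congr quotv_pi; apply: subvs_inj; rewrite [LHS](@sub_complex_diffE _ _ (sc_chains A)) /= !vsprojK //.
by apply: (subvP (sc_stable A q)); rewrite memv_img.
Qed.

Lemma dim_rel_chains q A B : B \subset A ->
  \dim {: quot_complex (sub_sub (sc_chains A) (sc_chains B)) q} =
  #|[set s in A :\: B | cdim s == q]|.
Proof.
move=> BA; have e : (rclass q A B @: chain_of A q)%VS = fullv.
  apply/vspaceP => x; rewrite memvf; have [c cA <-] := rclass_surj x.
  exact: memv_img.
rewrite -e; apply/eqP; rewrite -(eqn_add2l (\dim (chain_of A q :&: lker (rclass q A B)))).
rewrite limg_ker_dim dim_chain_of.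
have -> : (chain_of A q :&: lker (rclass q A B))%VS = chain_of B q.
  apply/vspaceP => c; rewrite memv_cap memv_ker; apply/andP/idP => [[cA]|cB].
    by rewrite rclass_eq0.
  have cA := subvP (chain_ofS q BA) _ cB; by rewrite rclass_eq0.
rewrite dim_chain_of -(cardsID B); apply/eqP; congr (_ + _)%N; apply: eq_card => s.
  rewrite !inE; case: (boolP (s \in B)) => [sB|]; last by rewrite andbF.
  by rewrite (subsetP BA) //= andbT.
by rewrite !inE andbA andbAC -andbA.
Qed.

End Classes.

(** * The double complex *)

(** Stability is stated for chains; testing it on the basis chain of [t], whose boundary has
    coefficient [kappa t s] at [s], turns it into closure under faces. *)
Lemma subcomplex_face (F : fieldType) (X : cell_complex F) (A : subcomplex X) (s t : X) :
  t \in A -> kappa t s != 0 -> s \in A.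
Proof.
move=> tA ts; have tq : cdim t == (cdim s).+1 by rewrite (kappa_dim ts).
pose t' : qcell X (cdim s).+1 := Sub t tq; pose s' : qcell X (cdim s) := exist _ s (eqxx _).
have bA : bchain t' \in chain_of A (cdim s).+1.
  apply/chain_ofP => r rA; rewrite ffunE; case: eqP => // e.
  by rewrite e tA in rA.
have /chain_ofP/(_ s') b0 := subvP (sc_stable A (cdim s)) _ (memv_img _ bA).
apply/negPn/negP => /b0 /eqP; rewrite bdryE (bigD1 t') //= big1 => [|r rt].
  by rewrite addr0 ffunE eqxx mul1r (negPf ts).
by rewrite ffunE (negPf rt) mul0r.
Qed.

Lemma cyclesSE (F : fieldType) (X : cell_complex F) q (c : chain X q.+1) :
  (c \in cycles (cell_chain_complex X) q.+1) = (bdry X q c == 0).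
Proof. exact: memv_ker. Qed.

Section DoubleComplex.
Variables (F : fieldType) (n : nat) (X : cell_complex F) (K : filtration n X) (u : 'rV[int]_n).
Local Notation cell_set := (X * {set 'I_n})%type.
Local Notation W := {ffun cell_set -> F^o}.
Implicit Types (s t : {set 'I_n}) (w : W) (x : cell_set).

Let gr s : subcomplex X := K (u - unit_grade s).

(** The double complex lives in the single space [W] of functions on pairs of a cell and a set of
    directions; its pieces are the subspaces supported on [bideg p q] or [totdeg m]. Both
    differentials are thus endomorphisms of [W], and [slice] and [glue] translate to and from
    chains. *)
Definition slice q s : 'Hom(W, chain X q) :=
  linfun (fun w : W => [ffun c : qcell X q => w (val c, s)] : chain X q).

Lemma sliceE q s w c : slice q s w c = w (val c, s).
Proof. by rewrite linfunK ?ffunE // => a x y; apply/ffunP => d; rewrite !ffunE. Qed.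

Definition glue q (y : {set 'I_n} -> chain X q) : W :=
  [ffun x : cell_set => (if insub x.1 is Some c then y x.2 c else 0) : F^o].

Lemma slice_glue q y s : slice q s (glue y) = y s.
Proof. by apply/ffunP => c; rewrite sliceE ffunE /= valK. Qed.

(* The sign makes [dv] and [kh] anticommute. *)
Definition dv : 'End(W) :=
  linfun (fun w : W => [ffun x : cell_set => (-1) ^+ #|x.2| * \sum_c (w (c, x.2) : F) * kappa c x.1] : W).

Definition kh : 'End(W) :=
  linfun (fun w : W => [ffun x : cell_set => \sum_(s : {set 'I_n}) \sum_(j in s | s :\ j == x.2)
    koszul_sign F s j * (w (x.1, s) : F)] : W).

Definition dtot : 'End(W) := (dv + kh)%VF.

Lemma dvE w x : dv w x = (-1) ^+ #|x.2| * \sum_c (w (c, x.2) : F) * kappa c x.1.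
Proof.
rewrite linfunK ?ffunE // => a v v'; apply/ffunP => y; rewrite !ffunE.
rewrite [_ *: (_ * _)]mulrCA -mulrDr [a * _]mulr_sumr -big_split; congr (_ * _).
by apply: eq_bigr => c _; rewrite !ffunE /= mulrDl mulrA.
Qed.

Lemma khE w x : kh w x = \sum_(s : {set 'I_n}) \sum_(j in s | s :\ j == x.2)
  koszul_sign F s j * (w (x.1, s) : F).
Proof.
rewrite linfunK ?ffunE // => a v v'; apply/ffunP => y; rewrite !ffunE.
rewrite [_ *: (\sum_(_ | _) _)]mulr_sumr -big_split; apply: eq_bigr => s _.
rewrite mulr_sumr -big_split; apply: eq_bigr => j _.
by rewrite !ffunE /= mulrDr mulrCA.
Qed.

Lemma dtotE w : dtot w = dv w + kh w.
Proof. exact: add_lfunE. Qed.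

Lemma dv2 w : dv (dv w) = 0.
Proof.
apply/ffunP => -[c s]; rewrite dvE ffunE /= [X in _ * X](_ : _ = 0) ?mulr0 //.
under eq_bigr do rewrite dvE -mulrA mulr_suml /=.
rewrite -mulr_sumr exchange_big /= big1 ?mulr0 // => r _.
under eq_bigr do rewrite -mulrA.
by rewrite -mulr_sumr kappa_kappa mulr0.
Qed.

(** As for the Koszul complex: grouping the double sum by the initial set [r], the two orders of
    removing a pair of directions cancel by [koszul_sign_sum]. *)
Lemma kh2 w : kh (kh w) = 0.
Proof.
apply/ffunP => -[c t]; rewrite khE ffunE /=.
pose b s j (r : {set 'I_n}) k := [&& k \in r, r :\ k == s, j \in s & s :\ j == t].
transitivity (\sum_(s : {set 'I_n}) \sum_j \sum_(r : {set 'I_n}) \sum_k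
    if b s j r k then koszul_sign F s j * koszul_sign F r k * (w (c, r) : F) else 0).
  apply: eq_bigr => s _; rewrite big_mkcond; apply: eq_bigr => j _.
  rewrite khE /=; case: ifPn => [/andP[js st]|sj]; last first.
    by rewrite big1 // => r _; rewrite big1 // => k _; rewrite /b (negPf sj) !andbF.
  rewrite mulr_sumr; apply: eq_bigr => r _; rewrite mulr_sumr big_mkcond.
  by apply: eq_bigr => k _; rewrite /b js st !andbT mulrA.
under eq_bigr => s _ do rewrite exchange_big.
rewrite exchange_big big1 //= => r _.
rewrite exchange_big /=; under eq_bigr => j _ do rewrite exchange_big.
have /(congr1 (fun a : F => a * (w (c, r) : F))) := koszul_sign_sum F r t.
rewrite mul0r; apply: etrans; rewrite mulr_suml.
apply: eq_bigr => j _; rewrite mulr_suml; apply: eq_bigr => k _ /=.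
rewrite (bigD1 (r :\ k)) //= big1 ?addr0 => [|s ns].
  by rewrite /b eqxx !inE /= -!andbA [(j != k) && (_ && _)]andbCA; case: ifP; rewrite ?mul0r.
by rewrite /b eq_sym (negPf ns) andbF.
Qed.

Lemma dv_kh w : dv (kh w) = - kh (dv w).
Proof.
apply/ffunP => -[c t]; rewrite dvE ffunE khE /=.
under eq_bigr do rewrite khE mulr_suml.
rewrite exchange_big /= mulr_sumr -sumrN; apply: eq_bigr => s _.
under eq_bigr do rewrite mulr_suml.
rewrite exchange_big /= mulr_sumr -sumrN; apply: eq_bigr => j /andP[js /eqP <-].
rewrite dvE /= (cardsD1 j s) js add1n exprS mulN1r mulNr mulrN opprK mulrCA.
by congr (_ * _); rewrite mulr_sumr; apply: eq_bigr => d _; rewrite mulrA.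
Qed.

Lemma dtot2 w : dtot (dtot w) = 0.
Proof. by rewrite !dtotE !linearD /= dv2 kh2 dv_kh add0r addr0 addNr. Qed.

Definition bideg p q : {set cell_set} :=
  [set x | [&& x.1 \in gr x.2, #|x.2| == p & cdim x.1 == q]].

Definition totdeg m : {set cell_set} := [set x | (x.1 \in gr x.2) && (cdim x.1 + #|x.2| == m)%N].

Lemma bideg_totdeg p q : bideg p q \subset totdeg (q + p).
Proof. by apply/subsetP => x; rewrite !inE => /and3P[-> /eqP-> /eqP->] /=. Qed.

Lemma slice_supp p q s w : w \in supp F (bideg p q) -> slice q s w \in chain_of (gr s) q.
Proof.
move/suppP => h; apply/chain_ofP => c cs; rewrite sliceE; apply: h.
by rewrite inE (negPf cs).
Qed.

Lemma glue_supp p q y : (forall s, y s \in chain_of (gr s) q) ->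
  (forall s, #|s| != p -> y s = 0) -> glue y \in supp F (bideg p q).
Proof.
move=> yg y0; apply/suppP => -[c s]; rewrite !inE ffunE /=.
case: insubP => //= d dq dc; rewrite dq andbT negb_and -dc => /orP[ds|/y0 ->]; last by rewrite ffunE.
by have /chain_ofP/(_ _ ds) := yg s.
Qed.

Lemma supp_slice_eq p q w w' : w \in supp F (bideg p q) -> w' \in supp F (bideg p q) ->
  (forall s, #|s| = p -> slice q s w = slice q s w') -> w = w'.
Proof.
move=> /suppP h /suppP h' e; apply/ffunP => -[c s].
have [|/[dup]/h -> /h' -> //] := boolP ((c, s) \in bideg p q).
rewrite inE /= => /and3P[_ /eqP sp cq].
by have /ffunP/(_ (Sub c cq)) := e s sp; rewrite !sliceE.
Qed.

Lemma slice_dv q s w : slice q s (dv w) = (-1) ^+ #|s| *: bdry X q (slice q.+1 s w).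
Proof.
apply/ffunP => c; rewrite sliceE dvE ffunE bdryE /=; congr (_ * _).
rewrite (bigID (fun d : X => cdim d == q.+1)) /= [Y in _ + Y]big1 ?addr0.
  rewrite (big_qcell q.+1 (fun d => (w (d, s) : F) * kappa d (val c))).
  by apply: eq_bigr => d _; rewrite sliceE.
move=> d dq; have [->|/kappa_dim e] := eqVneq (kappa d (val c)) 0; first by rewrite mulr0.
by case/negP: dq; rewrite e (eqP (valP c)).
Qed.

Lemma slice_kh q t w : slice q t (kh w) =
  \sum_(s : {set 'I_n}) \sum_(j in s | s :\ j == t) koszul_sign F s j *: slice q s w.
Proof.
apply/ffunP => c; rewrite sliceE khE sum_ffunE; apply: eq_bigr => s _.
by rewrite sum_ffunE; apply: eq_bigr => j _; rewrite ffunE sliceE.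
Qed.

Lemma dv_supp p q w : w \in supp F (bideg p q.+1) -> dv w \in supp F (bideg p q).
Proof.
move/suppP => h; apply/suppP => -[c s]; rewrite inE dvE /= => cs.
rewrite big1 ?mulr0 // => d _.
have [->|ne] := eqVneq (kappa d c) 0; first by rewrite mulr0.
rewrite h ?mul0r //; apply: contra cs; rewrite inE /= => /and3P[dg -> dq].
rewrite (subcomplex_face dg ne) /=; move: dq.
by rewrite (kappa_dim ne) eqSS.
Qed.

Lemma dv_supp0 p w : w \in supp F (bideg p 0) -> dv w = 0.
Proof.
move/suppP => h; apply/ffunP => -[c s]; rewrite dvE ffunE /= big1 ?mulr0 // => d _.
have [->|ne] := eqVneq (kappa d c) 0; first by rewrite mulr0.
by rewrite h ?mul0r // inE /= (kappa_dim ne) !andbF.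
Qed.

Lemma gr_sub s t : t \subset s -> gr s \subset gr t.
Proof. by move=> ts; apply/fil_mono/preceq_unit_grade. Qed.

Lemma kh_supp p q w : w \in supp F (bideg p.+1 q) -> kh w \in supp F (bideg p q).
Proof.
move/suppP => h; apply/suppP => -[c t]; rewrite inE khE /= => ct.
rewrite big1 // => s _; rewrite big1 // => j /andP[js /eqP st].
rewrite h ?mulr0 //; apply: contra ct; rewrite inE /= -st => /and3P[cg sp ->].
rewrite (subsetP (gr_sub (subD1set s j)) _ cg) /= andbT.
by move: sp; rewrite (cardsD1 j) js.
Qed.

Lemma kh_supp0 q w : w \in supp F (bideg 0 q) -> kh w = 0.
Proof.
move/suppP => h; apply/ffunP => -[c t]; rewrite khE ffunE /=.
rewrite big1 // => s _; rewrite big1 // => j /andP[js /eqP st].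
by rewrite h ?mulr0 // inE /= (cardsD1 j) js andbF.
Qed.

(** * Vertical cycles and the Koszul complexes of homology *)

Definition vcycles p q : {vspace W} := (supp F (bideg p q) :&: lker dv)%VS.

Lemma slice_vcycles p q s w : w \in vcycles p q -> slice q s w \in cycles_of (gr s) q.
Proof.
rewrite !memv_cap memv_ker => /andP[wb /eqP dw]; rewrite (slice_supp s wb) /=.
case: q wb => [|q] wb; first exact: memvf.
have := slice_dv q s w; rewrite dw linear0 => /esym/eqP.
by rewrite scaler_eq0 signr_eq0 /= cyclesSE.
Qed.

Lemma glue_vcycles p q y : (forall s, y s \in cycles_of (gr s) q) ->
  (forall s, #|s| != p -> y s = 0) -> glue y \in vcycles p q.
Proof.
move=> yg y0; have gb : glue y \in supp F (bideg p q).
  by apply: glue_supp => // s; have := yg s; rewrite memv_cap => /andP[].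
rewrite memv_cap gb memv_ker /=; apply/eqP.
case: q y yg y0 gb => [|q] y yg y0 gb; first exact: dv_supp0 gb.
apply: supp_slice_eq (dv_supp gb) _ _; first exact: mem0v.
move=> s _; rewrite slice_dv slice_glue linear0.
have := yg s; rewrite memv_cap => /andP[_]; rewrite cyclesSE => /eqP->.
by rewrite scaler0.
Qed.

Local Notation PH q := (persistent_homology K q).

(** Restricted to [vcycles p q], this is the quotient map by the vertical boundaries, and it carries
    [kh] to the Koszul differential. *)
Definition koszul_class p q : 'Hom(W, koszul_obj (PH q) u p) :=
  linfun (fun w => dsum_mk (T := fun s : subsets_of_size n p => PH q (u - unit_grade (val s)))
    (fun s : subsets_of_size n p => hclass q (gr (val s)) (slice q (val s) w))).

Lemma koszul_classE p q w (s : subsets_of_size n p) :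
  dsum_proj s (koszul_class p q w) = hclass q (gr (val s)) (slice q (val s) w).
Proof.
rewrite linfunK ?dsum_projE // => a x y; apply: dsumP => t.
by rewrite linearP /= !dsum_projE !linearP.
Qed.

Lemma koszul_class_surj p q : (koszul_class p q @: vcycles p q)%VS = fullv.
Proof.
apply/vspaceP => x; rewrite memvf.
have ex (s : subsets_of_size n p) : exists c,
    (c \in cycles_of (gr (val s)) q) && (hclass q (gr (val s)) c == dsum_proj s x).
  by have [c cZ <-] := hclass_surj (dsum_proj s x); exists c; rewrite cZ /=.
(* The chosen representatives are extended by 0 to sets of other sizes, which keeps the glued
   function in Koszul degree [p]. *)
pose y s := if (insub s : option (subsets_of_size n p)) is Some s' then xchoose (ex s') else 0.
suff -> : x = koszul_class p q (glue y).
  apply/memv_img/glue_vcycles => s; rewrite /y; case: insubP => [s' sp <-|sp] //.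
  - by have /andP[] := xchooseP (ex s').
  - by rewrite mem0v.
  - by rewrite (valP s').
apply: dsumP => s; rewrite koszul_classE slice_glue /y valK.
by have /andP[_ /eqP] := xchooseP (ex s).
Qed.

Lemma koszul_class_ker p q :
  (vcycles p q :&: lker (koszul_class p q))%VS = (dv @: supp F (bideg p q.+1))%VS.
Proof.
apply/vspaceP => w; rewrite memv_cap memv_ker; apply/andP/memv_imgP => [[wZ /eqP Pw]|[v vb ->]].
  (* The slice is bounded up to the sign [(-1) ^+ p], which cancels the sign that [dv] puts on sets
     of size [p]. *)
  have ex (s : subsets_of_size n p) : exists c,
      (c \in chain_of (gr (val s)) q.+1) && (bdry X q c == (-1) ^+ p *: slice q (val s) w).
    have /eqP := koszul_classE q w s; rewrite Pw linear0 eq_sym hclass_eq0 ?(slice_vcycles _ wZ) //.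
    case/memv_imgP=> c cA e; exists ((-1) ^+ p *: c); rewrite memvZ //=.
    by rewrite linearZ /= -e.
  pose y s := if (insub s : option (subsets_of_size n p)) is Some s' then xchoose (ex s') else 0.
  have gb : glue y \in supp F (bideg p q.+1).
    apply: glue_supp => s; rewrite /y; case: insubP => [s' sp <-|sp] //.
    - by have /andP[] := xchooseP (ex s').
    - by rewrite mem0v.
    - by rewrite (valP s').
  exists (glue y) => //; move: wZ; rewrite memv_cap => /andP[wb _].
  apply: supp_slice_eq wb (dv_supp gb) _ => s /eqP sp.
  rewrite slice_dv slice_glue /y insubT.
  have /andP[_ /eqP ->] := xchooseP (ex (Sub s sp)).
  by rewrite scalerA (eqP sp) -expr2 sqrr_sign scale1r.
have vZ : dv v \in vcycles p q by rewrite memv_cap dv_supp //= memv_ker dv2.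
split=> //; apply/eqP/dsumP => s; rewrite koszul_classE linear0; apply/eqP.
rewrite hclass_eq0 ?(slice_vcycles _ vZ) // slice_dv memvZ // memv_img //.
exact: slice_supp vb.
Qed.

Lemma koszul_class_kh p q w : w \in vcycles p.+1 q ->
  koszul_class p q (kh w) = koszul_diff (PH q) u p (koszul_class p.+1 q w).
Proof.
move=> wZ; rewrite koszul_diffE; apply: dsumP => t; rewrite koszul_classE dsum_projE.
rewrite slice_kh linear_sum /=.
rewrite (bigID (fun s : {set 'I_n} => #|s| == p.+1)) /= [Y in _ + Y = _]big1 ?addr0; last first.
  move=> s sp; rewrite big1 ?linear0 // => j /andP[js /eqP st]; case/negP: sp.
  by rewrite (cardsD1 j) js st (eqP (valP t)).
rewrite (reindex_omap (val : subsets_of_size n p.+1 -> {set 'I_n}) insub) => [|s sp]; last by rewrite insubT.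
apply: eq_big => [s|s _]; first by rewrite (valP s) valK eqxx.
rewrite linear_sum /=; apply: eq_bigr => j /andP[js /eqP st].
rewrite linearZ /= koszul_classE hclass_incl ?(slice_vcycles _ wZ) //.
by apply: gr_sub; rewrite -st subD1set.
Qed.


Definition koszul_rank p q : nat :=
  if p is p'.+1 then \dim (limg (koszul_diff (PH q) u p')) else 0.

(** Rank-nullity for [koszul_class] splits the vertical cycles into vertical boundaries and the
    Koszul chains of degree [p]; the latter split into homology and the ranks of the outgoing and
    incoming differentials. *)
Lemma xi_vcycles p q : (xi K p q u + koszul_rank p q + koszul_rank p.+1 q +
    \dim (dv @: supp F (bideg p q.+1)) = \dim (vcycles p q))%N.
Proof.
rewrite -(limg_ker_dim (koszul_class p q) (vcycles p q)) koszul_class_ker koszul_class_surj.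
rewrite [RHS]addnC addnAC addnAC; congr (_ + _)%N.
have := dim_homology (koszul_complex (PH q) u) p.
rewrite -/(betti _ p u) -/(xi K p q u) -/(koszul_rank p.+1 q) addnAC => ->.
case: p => [|p]; first by rewrite addn0.
rewrite -(limg_ker_dim (koszul_diff (PH q) u p) fullv) capfv.
by congr (_ + _)%N.
Qed.

Lemma dim_vcycles0 p : \dim (vcycles p 0) = #|bideg p 0|.
Proof.
rewrite -(dim_supp F); congr (\dim _); apply/vspaceP => w; rewrite memv_cap memv_ker.
by case: (boolP (w \in _)) => // /dv_supp0 ->; rewrite eqxx.
Qed.

Lemma dim_vcyclesS p q :
  (\dim (vcycles p q.+1) + \dim (dv @: supp F (bideg p q.+1)) = #|bideg p q.+1|)%N.
Proof. by rewrite limg_ker_dim dim_supp. Qed.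

Lemma card_totdeg m : #|totdeg m| = (\sum_(0 <= p < m.+1) #|bideg p (m - p)|)%N.
Proof.
(* On [totdeg m] the size of the set is at most [m], so [inord] loses nothing. *)
rewrite -sum1_card (partition_big (fun x => inord #|x.2| : 'I_m.+1) predT) //= big_mkord.
apply: eq_bigr => p _; rewrite -sum1_card; apply: eq_bigl => x; rewrite !inE -andbA.
case: (x.1 \in gr x.2) => //=; apply/andP/andP => [[/eqP e]|[/eqP xp /eqP xq]].
  rewrite -val_eqE /= inordK; last by rewrite ltnS -e leq_addl.
  by move=> /eqP <-; rewrite eqxx -[X in (X - _)%N]e addnK.
have pm : (p <= m)%N by rewrite -ltnS.
by rewrite xp xq subnK // inord_val.
Qed.

(* A class [dv a + kh b] with [dv b = 0] is the leading term of the boundary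
   [dtot (a + b) = (dv a + kh b) + kh a]. *)
Lemma dim_ker_dtot m :
  (\dim (vcycles 0 m) + \sum_(1 <= p < m.+1)
      (\dim (dv @: supp F (bideg p (m - p).+1)) + koszul_rank p.+1 (m - p))
    <= \dim (supp F (totdeg m) :&: lker dtot))%N.
Proof.
set V := (_ :&: _)%VS.
have := dim_filtration (fun x : cell_set => #|x.2|) V m.+1.
move/leq_trans => /(_ _ (dimvS (capvSl _ _))); apply: leq_trans.
rewrite big_add1 big_nat_recl //; apply: leq_add.
  apply: dimvS; apply/subvP => w wZ; have := wZ; rewrite memv_cap memv_ker => /andP[wb /eqP dw].
  have -> : w = restr F [set x : cell_set | #|x.2| == 0] w.
    apply/ffunP => x; rewrite restrE inE; case: ifP => // x0.
    by have /suppP -> // := wb; rewrite inE x0 andbF.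
  apply: memv_img; rewrite !memv_cap memv_ker dtotE dw (kh_supp0 wb) addr0 eqxx.
  have -> : w \in supp F (totdeg m).
    by apply: (subvP (suppS F _)) wb; rewrite -[X in totdeg X]addn0 bideg_totdeg.
  apply: (subvP (suppS F _)) wb; apply/subsetP => x; rewrite !inE => /and3P[_ /eqP -> _].
  by [].
rewrite /= big_nat [X in (_ <= X)%N]big_nat; apply: leq_sum => p pm.
have pm' : (p.+1 <= m)%N by [].
set q := (m - p.+1)%N; have mE : m = (q + p.+1)%N by rewrite subnK.
pose B := (dv @: supp F (bideg p.+1 q.+1) + kh @: vcycles p.+2 q)%VS.
apply: (@leq_trans (\dim B)).
  (* The two summands of the bound are found in the kernel and the image of [koszul_class p.+1 q] on
     [B]: the vertical boundaries in the former, the image of the Koszul differential in the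
     latter. *)
  rewrite -(limg_ker_dim (koszul_class p.+1 q) B); apply: leq_add; apply: dimvS.
    by rewrite -koszul_class_ker subv_cap capvSr koszul_class_ker addvSl.
  apply/subvP => _ /memv_imgP[y _ ->]; have : y \in (koszul_class p.+2 q @: vcycles p.+2 q)%VS.
    by rewrite koszul_class_surj memvf.
  case/memv_imgP=> w wZ ->; rewrite -koszul_class_kh // memv_img //.
  by apply: (subvP (addvSr _ _)); rewrite memv_img.
apply: dimvS; apply/subvP => _ /memv_addP[_ /memv_imgP[a ab ->] [_ /memv_imgP[b bZ ->] ->]].
have [bb /eqP db] : b \in supp F (bideg p.+2 q) /\ dv b == 0.
  by move: bZ; rewrite memv_cap memv_ker => /andP[].
have da := dv_supp ab; have hb := kh_supp bb; have ha := kh_supp ab.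
have e : dtot (a + b) = dv a + kh b + kh a.
  by rewrite dtotE !linearD /= db addr0 [kh a + _]addrC addrA.
have -> : dv a + kh b = restr F [set x : cell_set | #|x.2| == p.+1] (dtot (a + b)).
  apply/ffunP => x; rewrite e restrE inE !ffunE.
  case: ifPn => xp.
    have /suppP -> := ha; first by rewrite addr0.
    by rewrite inE (eqP xp) eqn_leq ltnn /= andbF.
  by have /suppP -> := da; [have /suppP -> := hb|]; rewrite ?addr0 // inE (negPf xp) /= andbF.
have sS A (w : W) : w \in supp F A -> A \subset totdeg m -> w \in supp F (totdeg m).
  by move=> wA AB; apply: (subvP (suppS F AB)).
have sL k k' (w : W) : w \in supp F (bideg k k') -> (k <= p.+1)%N ->
    w \in supp F [set x : cell_set | (#|x.2| < p.+2)%N].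
  move=> wA kp; apply: (subvP (suppS F _)) wA; apply/subsetP => x.
  by rewrite !inE => /and3P[_ /eqP -> _].
apply: memv_img; rewrite !memv_cap memv_ker dtot2 eqxx andbT e; apply/andP; split.
  rewrite !memvD //.
  - by apply: sS da _; rewrite mE bideg_totdeg.
  - by apply: sS hb _; rewrite mE bideg_totdeg.
  - by apply: sS ha _; rewrite mE -addSnnS bideg_totdeg.
by rewrite !memvD // ?(sL _ _ _ da) ?(sL _ _ _ hb) ?(sL _ _ _ ha).
Qed.

(** * One-criticality and the matching of cells *)

Lemma gr0 : gr set0 = K u.
Proof. by congr (K _); apply/rowP => j; rewrite !mxE inE subr0. Qed.

Definition entry_directions (c : X) : {set 'I_n} := [set j | c \in gr [set j]].

(** By one-criticality, membership is a coordinatewise comparison with one grade [f c], so the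
    directions in [s] can be tested one at a time. Hence the sets lying over a cell of [K u] form a
    full power set. *)
Lemma grE c s : (c \in gr s) = (c \in K u) && (s \subset entry_directions c).
Proof.
apply/idP/andP => [cs|[cu /subsetP sJ]].
  rewrite -gr0 (subsetP (gr_sub (sub0set s)) _ cs); split=> //.
  apply/subsetP => j js; rewrite inE; apply: (subsetP (gr_sub _)) cs.
  by rewrite sub1set.
have [f [_ fE]] := fil_one_critical K.
move: cu; rewrite !fE !inE => /forallP cu; apply/forallP => j; rewrite !mxE.
case: (boolP (j \in s)) => [/sJ|_]; last by rewrite subr0.
by rewrite inE fE inE => /forallP/(_ j); rewrite !mxE inE eqxx.
Qed.

Lemma fil_boundaryE c : (c \in fil_boundary K u) = (entry_directions c != set0).
Proof.
apply/bigcupP/set0Pn => [[j _ cj]|[j]]; first by exists j; rewrite inE.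
by rewrite inE; exists j.
Qed.

Lemma fil_boundary_sub : fil_boundary K u \subset K u.
Proof.
apply/subsetP => c /bigcupP[j _ cj]; rewrite -gr0.
exact: (subsetP (gr_sub (sub0set _))) cj.
Qed.

(* The cells containing a chosen direction of their first factor; removing that
   direction matches them with the remaining cells over [fil_boundary K u]. *)
Definition matched m : {set cell_set} :=
  [set x in totdeg m | if [pick j in entry_directions x.1] is Some j then j \in x.2 else false].

Lemma matched0 : matched 0 = set0.
Proof.
apply/setP => x; rewrite !inE addn_eq0 cards_eq0.
by case: (x.2 =P set0) => [->|]; rewrite ?andbF //; case: pickP => *; rewrite ?inE ?andbF.
Qed.

(** Take [(c, s)] in the support of [w] with [cdim c] maximal, let [j] be the chosen direction of
    [c], and evaluate [dtot w] at [(c, s :\ j)]. Maximality kills the vertical terms. A Koszul term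
    from [t] needs [j] in [t], which forces [t = s], so only [w (c, s)] up to sign survives. *)
Lemma dtot_matched_inj m : (supp F (matched m) :&: lker dtot)%VS = 0%VS.
Proof.
apply/eqP; rewrite -subv0; apply/subvP => w; rewrite memv_cap memv_ker memv0 => /andP[/suppP wm /eqP dw].
apply: contraT => w0.
have [x0 wx0] : exists x, w x != 0.
  apply/existsP; apply: contraNT w0; rewrite negb_exists => /forallP h.
  by apply/eqP/ffunP => x; rewrite ffunE; apply/eqP; rewrite -[_ == _]negbK h.
have [[c s] /= wcs cmax] := @arg_maxnP _ x0 (fun x => w x != 0) (fun x => cdim x.1) wx0.
have : (c, s) \in matched m by apply: contraNT wcs => /wm ->.
rewrite inE => /andP[_] /=; case pickE: [pick j in _] => [j|//] js.
have /ffunP/(_ (c, s :\ j)) := dw.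
rewrite dtotE !ffunE dvE khE /= big1 => [|d _]; last first.
  have [->|ne] := eqVneq (kappa d c) 0; first by rewrite mulr0.
  have [->|/cmax /=] := eqVneq (w (d, s :\ j)) 0; first by rewrite mul0r.
  by rewrite (kappa_dim ne) ltnn.
rewrite mulr0 add0r (bigD1 s) //= (bigD1 j) /=; last by rewrite js eqxx.
rewrite big1 => [|k /andP[/andP[ks /eqP e] kj]]; last first.
  by have := setD11 k s; rewrite e !inE ks kj.
rewrite addr0 big1 => [|t ts]; last first.
  rewrite big1 // => k /andP[kt /eqP e]; rewrite wm ?mulr0 // inE /= pickE.
  apply/negP => /andP[_ jt]; have [kj|kj] := eqVneq k j.
    by case/eqP: ts; rewrite -(setD1K js) -(setD1K jt) -e kj.
  by have := setD11 j s; rewrite -e !inE eq_sym kj jt.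
move/eqP; rewrite addr0 mulf_eq0 signr_eq0 /= => /eqP w1.
by rewrite w1 eqxx in wcs.
Qed.

Local Notation RC := (quot_complex (sub_sub (sc_chains (K u)) (sc_chains (fil_boundary K u)))).

(** The map [rho] projects to relative chains through the empty set of directions. On the image of
    [dtot], its kernel contains the injective image of the matched part, and its own image contains
    every relative boundary. *)
Lemma rank_dtot q : (\dim (limg (cc_diff RC q)) + #|matched q.+1|
  <= \dim (dtot @: supp F (totdeg q.+1)))%N.
Proof.
pose rho := (rclass q (K u) (fil_boundary K u) \o slice q set0)%VF.
rewrite -(limg_ker_dim rho (dtot @: supp F (totdeg q.+1))) addnC; apply: leq_add.
  rewrite -(dim_supp F) -(limg_dim_eq (dtot_matched_inj q.+1)).
  apply: dimvS; apply/subvP => _ /memv_imgP[w wm ->]; rewrite memv_cap memv_ker.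
  rewrite memv_img /=; last by apply: (subvP (suppS F _)) wm; apply/subsetP => x; rewrite inE => /andP[].
  move/suppP: wm => wm; rewrite lfunE /=.
  (* Over the empty set no cell is matched, so [dv] contributes nothing; [kh] contributes at [c]
     only if [c] has an entry direction, that is, lies in [fil_boundary K u]. *)
  have dB : slice q set0 (dtot w) \in chain_of (fil_boundary K u) q.
    apply/chain_ofP => c cB; rewrite sliceE dtotE ffunE dvE khE /=.
    rewrite [X in _ * X]big1 ?mulr0 ?add0r => [|d _]; last first.
      rewrite wm ?mul0r // inE /=; case: pickP => [j _|_]; rewrite ?inE andbF //.
    rewrite big1 // => s _; rewrite big1 // => j /andP[js _].
    rewrite wm ?mulr0 // inE /=; case: pickP => [k|_]; last by rewrite andbF.
    by move: cB; rewrite fil_boundaryE negbK => /eqP -> /=; rewrite inE.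
  by rewrite rclass_eq0 // (subvP (chain_ofS q fil_boundary_sub)).
apply: dimvS; apply/subvP => _ /memv_imgP[x _ ->].
have [c cA <-] := rclass_surj x.
(* Placing [c] over the empty set lifts the relative chain to bidegree [(0, q.+1)], where [kh]
   vanishes. *)
pose y (s : {set 'I_n}) := if s == set0 then c else 0.
have yb : glue y \in supp F (bideg 0 q.+1).
  apply: glue_supp => s; rewrite /y; case: (s =P set0) => [->|s0]; rewrite ?gr0 ?mem0v //.
  by rewrite cards0.
have -> : cc_diff RC q (rclass q.+1 (K u) (fil_boundary K u) c) = rho (dtot (glue y)).
  rewrite rclass_diff // dtotE (kh_supp0 yb) addr0 lfunE /= slice_dv slice_glue.
  by rewrite /y eqxx cards0 scale1r.
apply/memv_img/memv_img; apply: (subvP (suppS F _)) yb.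
by rewrite -[X in totdeg X]addn0 bideg_totdeg.
Qed.

(** A cell without entry directions occurs only over the empty set and is a relative cell. For the
    other cells, adding the chosen direction is a bijection from the unmatched pairs of degree [m]
    to the matched pairs of degree [m.+1]. *)
Lemma card_totdeg_matched m : #|totdeg m| =
  (#|[set c in K u :\: fil_boundary K u | cdim c == m]| + #|matched m| + #|matched m.+1|)%N.
Proof.
rewrite -(cardsID (matched m) (totdeg m)) [RHS]addnAC addnC; congr (_ + _)%N; last first.
  by rewrite (setIidPr _) //; apply/subsetP => x; rewrite inE => /andP[].
pose Q := [set x : cell_set | entry_directions x.1 == set0].
rewrite -(cardsID Q); congr (_ + _)%N.
  rewrite -(card_imset _ (f := fun c : X => (c, set0 : {set 'I_n}))); last by move=> c d [].
  apply: eq_card => -[c s]; rewrite !inE /=; apply/idP/imsetP => [|[d]].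
    case/andP=> /andP[_ /andP[cs cm]] /eqP c0.
    move: cs; rewrite grE c0 subset0 => /andP[cu /eqP s0]; exists c; last by rewrite s0.
    by move: cm; rewrite s0 cards0 addn0 !inE fil_boundaryE c0 eqxx cu.
  rewrite !inE fil_boundaryE negbK => /andP[/andP[/eqP d0 du] dm] [-> ->].
  rewrite grE du d0 sub0set cards0 addn0 dm eqxx /= andbT andbT.
  by case: pickP => // j _; rewrite inE.
set D := _ :\: Q.
have DE x : (x \in D) = [&& entry_directions x.1 != set0, x \in totdeg m &
    ~~ (if [pick j in entry_directions x.1] is Some j then j \in x.2 else false)].
  by rewrite !inE; case: (_ && (_ == m)); rewrite ?andbF ?andbT.
pose add x : cell_set :=
  (x.1, if [pick j in entry_directions x.1] is Some j then j |: x.2 else x.2).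
pose del x : cell_set :=
  (x.1, if [pick j in entry_directions x.1] is Some j then x.2 :\ j else x.2).
have addK : {in D, cancel add del}.
  move=> [c s]; rewrite DE /add /del /=.
  by case: [pick j in _] => //= j /and3P[_ _ js]; rewrite setU1K.
rewrite -(card_in_imset (can_in_inj addK)); apply: eq_card => -[c s]; apply/imsetP/idP.
  case=> -[d t]; rewrite DE !inE /add /= => + [-> ->].
  case: pickP => [j jJ|d0] /and3P[c0 /andP[dt dm] jt].
    rewrite cardsU1 jt add1n addnS eqSS dm andbT setU11 andbT grE subUset sub1set jJ.
    by move: dt; rewrite grE.
  by case/set0Pn: c0 => j; rewrite [_ \in _]d0.
rewrite inE /=; case pickE: [pick j in _] => [j|]; rewrite ?andbF // => /andP[+ js].
rewrite inE /= => /andP[cs cm]; exists (del (c, s)); last by rewrite /add /del /= pickE setD1K.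
rewrite DE !inE /del /= pickE !inE eqxx /= andbT (subsetP (gr_sub (subD1set s j)) _ cs) /=.
move: cm; rewrite (cardsD1 j s) js addnS eqSS => ->; rewrite andbT.
by case: pickP pickE => // k kJ _; apply/set0Pn; exists k.
Qed.

End DoubleComplex.

(** * Alternating sums *)

Section AlternatingSums.
Implicit Types a b : nat -> int.

Definition altsum a q : int := \sum_(0 <= i < q.+1) (-1) ^+ (q + i) * a i.

Lemma altsum0 a : altsum a 0 = a 0%N.
Proof. by rewrite /altsum big_nat1 mul1r. Qed.

Lemma altsumS a q : altsum a q.+1 = a q.+1 - altsum a q.
Proof.
rewrite /altsum big_nat_recr //= addrC -signr_odd addnn odd_double mul1r; congr (_ + _).
by rewrite -sumrN; apply: eq_bigr => i _; rewrite addSn exprS mulN1r mulNr.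
Qed.

Definition diagsum (f : nat -> nat -> nat) m : nat := (\sum_(0 <= p < m.+1) f p (m - p))%N.

Lemma diagsumS (f : nat -> nat -> nat) m :
  diagsum f m.+1 = (f 0 m.+1 + diagsum (fun p => f p.+1) m)%N.
Proof. by rewrite /diagsum big_nat_recl. Qed.

Lemma diagsumSr (f : nat -> nat -> nat) m :
  diagsum f m.+1 = (diagsum (fun p q => f p q.+1) m + f m.+1 0)%N.
Proof.
rewrite /diagsum big_nat_recr //= subnn; congr (_ + _)%N.
by apply: eq_big_nat => p pm; rewrite subSn // -ltnS.
Qed.

Lemma diagsumD (f g : nat -> nat -> nat) m :
  diagsum (fun p q => f p q + g p q)%N m = (diagsum f m + diagsum g m)%N.
Proof. exact: big_split. Qed.

Lemma eq_diagsum (f g : nat -> nat -> nat) m : f =2 g -> diagsum f m = diagsum g m.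
Proof. by move=> e; apply: eq_bigr => p _. Qed.

(** The numerical core. [M], [rq], [Q] are Morse numbers, ranks and cell numbers of the relative
    complex; [N] and [T] count matched and all pairs by total degree; [k] and [rk] are nullity and
    rank of [dtot]; [r] are Koszul ranks; [z], [b], [beta] are the dimensions of vertical cycles,
    vertical boundaries and chains by bidegree. *)
Lemma altsum_ineq (M Q N T rq k rk : nat -> nat) (xi r b z beta : nat -> nat -> nat) q :
  (rq 0 = 0)%N -> (forall i, M i + rq i + rq i.+1 = Q i)%N ->
  (N 0 = 0)%N -> (forall m, T m = Q m + N m + N m.+1)%N ->
  (forall p, r 0 p = 0)%N -> (forall p i, xi p i + r p i + r p.+1 i + b p i = z p i)%N ->
  (forall p, z p 0 = beta p 0)%N -> (forall p i, z p i.+1 + b p i = beta p i.+1)%N ->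
  (forall m, T m = diagsum beta m) ->
  (forall m, z 0 m + \sum_(1 <= p < m.+1) (b p (m - p) + r p.+1 (m - p)) <= k m)%N ->
  (forall m, k m + rk m = T m)%N ->
  (forall m, rq m.+1 + N m.+1 <= rk m.+1)%N ->
  altsum (fun i => (xi 0 i)%N%:Z - \sum_(1 <= p < i.+2) (xi p (i.+1 - p)%N)%:Z) q
    <= altsum (fun i => (M i)%:Z) q.
Proof.
move=> rq0 MQ N0 TQ r0 xz z0 zS Tb kz kT rkN.
pose t := diagsum xi; pose B := diagsum b; pose R := diagsum (fun p => r p.+1).
have zt m : diagsum z m = (t m + diagsum r m + R m + B m)%N.
  by rewrite /t /R /B -!diagsumD; apply: eq_diagsum => p i; rewrite xz.
have T0 : T 0%N = (t 0 + R 0 + B 0)%N.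
  have := zt 0%N; have := Tb 0%N; rewrite /diagsum !big_nat1 z0 r0 => -> ->.
  by rewrite addn0.
(* The ranks enter once in each of two consecutive total degrees, so [R] and [B] telescope in
   [altT]. *)
have TS m : T m.+1 = (t m.+1 + R m.+1 + B m.+1 + R m + B m)%N.
  have e : (diagsum (fun p i => z p i.+1) m + B m = diagsum (fun p i => beta p i.+1) m)%N.
    by rewrite -diagsumD; apply: eq_diagsum.
  have := zt m.+1; rewrite Tb [diagsum r _]diagsumS r0 add0n -/(R m) !diagsumSr z0.
  by move=> h; rewrite -e addnAC h; lia.
have kx m : (xi 0 m + R m + B m <= k m)%N.
  apply: leq_trans (kz m); rewrite -xz r0 big_split /= /R /B /diagsum.
  rewrite ![(\sum_(0 <= p < m.+1) _)%N]big_ltn //= subn0; lia.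
have altM m : altsum (fun i => (M i)%:Z) m = altsum (fun i => (T i)%:Z) m - (rq m.+1 + N m.+1)%N%:Z.
  elim: m => [|m IH]; last first.
    by rewrite !altsumS IH; have := MQ m.+1; have := TQ m.+1; lia.
  have M0 : (M 0 + rq 1 = Q 0)%N by rewrite -MQ rq0 addn0.
  have T0' : T 0%N = (Q 0 + N 1)%N by rewrite TQ N0 addn0.
  by rewrite !altsum0; lia.
have altT m : altsum (fun i => (T i)%:Z) m = altsum (fun i => (t i)%:Z) m + (R m + B m)%N%:Z.
  elim: m => [|m IH]; first by rewrite !altsum0 T0; lia.
  by rewrite !altsumS IH TS; lia.
have tS m : \sum_(1 <= p < m.+2) (xi p (m.+1 - p)%N)%:Z = (t m.+1)%:Z - (xi 0 m.+1)%N%:Z.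
  by rewrite /t /diagsum (big_morph Posz PoszD (erefl _)) [in RHS]big_ltn // subn0 addrC addKr.
(* By [tS] the [i]-th summand is [xi 0 i + xi 0 i.+1 - t i.+1]. The [xi 0] terms telescope, and the
   remaining [xi 0 0] equals [t 0], which completes the sum up to degree [m.+1]. *)
have altx m : altsum (fun i => (xi 0 i)%N%:Z - \sum_(1 <= p < i.+2) (xi p (i.+1 - p)%N)%:Z) m =
    (xi 0 m.+1)%N%:Z - altsum (fun i => (t i)%:Z) m.+1.
  elim: m => [|m IH]; last by rewrite [LHS]altsumS IH [in RHS]altsumS tS; lia.
  by rewrite altsum0 altsumS altsum0 tS [t 0%N]/diagsum big_nat1 subnn; lia.
(* Eliminating the alternating sums leaves [xi 0 q.+1 + R q.+1 + B q.+1 + rq q.+1 + N q.+1 <= T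
   q.+1]: the first three terms are bounded by the nullity [k q.+1], the last two by the rank
   [rk q.+1]. *)
rewrite altM altx; have := altT q.+1; rewrite !altsumS.
have := kx q.+1; have := kT q.+1; have := rkN q; lia.
Qed.

End AlternatingSums.

(** * Ranks in the relative complex and the final inequality *)

Definition relative_rank (F : fieldType) n (X : cell_complex F) (K : filtration n X)
    (u : 'rV[int]_n) q : nat :=
  if q is q'.+1 then
    \dim (limg (cc_diff (quot_complex
      (sub_sub (sc_chains (K u)) (sc_chains (fil_boundary K u)))) q'))
  else 0.

Lemma morse_number_rank (F : fieldType) n (X : cell_complex F) (K : filtration n X)
    (u : 'rV[int]_n) q :
  (morse_number K q u + relative_rank K u q + relative_rank K u q.+1 =
   #|[set c in K u :\: fil_boundary K u | cdim c == q]|)%N.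
Proof.
set C := quot_complex (sub_sub (sc_chains (K u)) (sc_chains (fil_boundary K u))).
rewrite addnAC -/C (dim_homology C q) -(dim_rel_chains q (fil_boundary_sub K u)) -/C.
case: q => [|q]; first by rewrite addn0.
by rewrite -(limg_ker_dim (cc_diff C q) fullv) capfv.
Qed.

Theorem theorem5p1 (F : fieldType) (n : nat) (hn : (1 <= n)%N)
    (X : cell_complex F) (K : filtration n X) (q : nat) (u : 'rV[int]_n) :
  \sum_(0 <= i < q.+1) (-1) ^+ (q + i) * (morse_number K i u)%:Z
  >= \sum_(0 <= i < q.+1) (-1) ^+ (q + i) *
       ((xi K 0 i u)%:Z - \sum_(1 <= p < i.+2) (xi K p (i.+1 - p) u)%:Z).
Proof.
pose b p q := \dim (dv n X @: supp F (bideg K u p q.+1)).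
pose T m := supp F (totdeg K u m).
pose k m := \dim (T m :&: lker (dtot n X)).
pose rk m := \dim (dtot n X @: T m).
apply: (@altsum_ineq (fun i => morse_number K i u)
  (fun m => #|[set c in K u :\: fil_boundary K u | cdim c == m]|)
  (fun m => #|matched K u m|) (fun m => #|totdeg K u m|) (relative_rank K u) k rk
  (fun p q => xi K p q u) (koszul_rank K u) b
  (fun p q => \dim (vcycles K u p q)) (fun p q => #|bideg K u p q|)) => //.
- exact: morse_number_rank.
- by rewrite matched0 cards0.
- exact: card_totdeg_matched.
- exact: xi_vcycles.
- exact: dim_vcycles0.
- exact: dim_vcyclesS.
- exact: card_totdeg.
- exact: dim_ker_dtot.
- by move=> m; rewrite /k /rk limg_ker_dim dim_supp.
- by move=> m; exact: rank_dtot.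
Qed.
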